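(* Let $0<a<1$ and let $R$ be the non-negative random variable with $E\left[e^{-zR}\right]=e^{-z^{a}}$ for $z>0$, with distribution function $F_R(y)=\Pr[R\le y]$. Then for all real $s>0$ and $t>0$, $$\int_{0}^{\infty}e^{-sx}\left(1-F_{R}\left(\frac{t}{x^{1/a}}\right)\right)dx=\frac1s\,E_{a}\left(-st^{a}\right).$$
   Context: $E_a(z)=\sum_{k=0}^{\infty}\frac{z^{k}}{\Gamma(1+ak)}$ is the Mittag-Leffler function; $E[\cdot]$ denotes expectation. *)

(* Defs.v *)
From HB Require Import structures.
From mathcomp Require Import all_boot all_order all_algebra.
From mathcomp Require Import all_classical all_reals all_analysis.
Import Order.TTheory GRing.Theory Num.Theory.
Import numFieldNormedType.Exports.

Set Implicit Arguments.
Unset Strict Implicit.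
Unset Printing Implicit Defensive.

Local Open Scope classical_set_scope.
Local Open Scope ring_scope.

(* Euler's integral, meaningful for 0 < x; for x <= 0 the integral diverges
   and [Rintegral] returns the default value 0. *)
Definition Gamma (R : realType) (x : R) : R :=
  \int[lebesgue_measure]_(u in `]0, +oo[) (u `^ (x - 1) * expR (- u)).

(* The series converges for all a > 0 and all z; only real z are covered. *)
Definition mittag_leffler (R : realType) (a z : R) : R :=
  limn (series (fun k : nat => z ^+ k / Gamma (1 + a * k%:R))).

(* Main.v *)
Require Import Defs.
From HB Require Import structures.
From mathcomp Require Import all_boot all_order all_algebra.
From mathcomp Require Import all_classical all_reals all_analysis.
From mathcomp Require Import measurable_realfun ring.
Import Order.TTheory GRing.Theory Num.Theory.
Import numFieldNormedType.Exports.

(** Let $M = R^{-a}$ and $c = s t^a$.  Almost surely $R > 0$, because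
$P(R \le 0) \le E[e^{-zR}] = e^{-z^a}$ for every $z > 0$
([probability_pos_compl]).  For $R > 0$ the event $t / x^{1/a} < R$ is
$(t/R)^a < x$, so Tonelli's theorem turns the left-hand side into
$$ E \int_{(t/R)^a}^{\infty} e^{-sx} dx = \frac1s E[e^{-cM}], $$
and it remains to show that $E[e^{-cM}] = E_a(-c)$, i.e. that $M$ has the
Mittag-Leffler distribution ([laplace_neg_power_stable]).

The moments of $M$ come from one integral, [integral_powR_expN]:
$$ \int_0^\infty p z^{p-1} e^{-r z^q} dz = r^{-p/q} \Gamma(1 + p/q). $$
It is $E[(\xi/r)^{p/q}]$ computed from the tail of $(\xi/r)^{1/q}$, where $\xi$
is a standard exponential variable; in the proof, $e^{-r z^q}$ is written
as the integral of $e^{-w}$ over $w > r z^q$ and the integrals are exchanged.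
Take $p = ak$ with $k \ge 1$.  For $q = a$ and $r = 1$ the value is $k!$.  But
$e^{-z^a} = E[e^{-zR}]$, so by Tonelli and the case $q = 1$, $r = R$ the same
integral is $\Gamma(1 + ak) E[R^{-ak}]$.  Hence
$E[M^k] = k! / \Gamma(1 + ak)$ ([moment_positive_stable]), and formally
$$ E[e^{-cM}] = \sum_k \frac{(-c)^k}{k!} E[M^k]
   = \sum_k \frac{(-c)^k}{\Gamma(1 + ak)} = E_a(-c). $$

The exchange of sum and expectation is dominated convergence: the partial
sums of $e^{-cM}$ are at most $e^{cM}$ in absolute value, and $e^{cM}$ is
integrable because $\Gamma(1 + p) \ge y^p e^{-y}$ for all $y \ge 0$
([extended_Gamma_ge]) makes $\sum_k c^k / \Gamma(1 + ak)$ converge. *)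

Local Open Scope classical_set_scope.
Local Open Scope ring_scope.

(** * Tonelli's theorem on a region *)

Lemma integral_if (d : measure_display) (T : measurableType d) (R : realType)
    (mu : {measure set T -> \bar R}) (b : T -> bool) (f : T -> \bar R) :
  (\int[mu]_(x in [set x | b x]) f x = \int[mu]_x (if b x then f x else 0))%E.
Proof.
rewrite integral_mkcond; apply: eq_integral => x _.
by rewrite patchE mem_setE.
Qed.

(** The form in which all exchanges of integrals below are made: each inner
integral runs over a section of the region where [b] holds. *)
Lemma tonelli_region (d1 d2 : measure_display) (T1 : measurableType d1)
    (T2 : measurableType d2) (R : realType)
    (m1 : {sigma_finite_measure set T1 -> \bar R})
    (m2 : {sigma_finite_measure set T2 -> \bar R})
    (b : T1 * T2 -> bool) (f : T1 * T2 -> \bar R) :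
  measurable_fun [set: T1 * T2] b -> measurable_fun [set: T1 * T2] f ->
  (forall x, 0 <= f x)%E ->
  (\int[m1]_x \int[m2]_(y in [set y | b (x, y)]) f (x, y) =
   \int[m2]_y \int[m1]_(x in [set x | b (x, y)]) f (x, y))%E.
Proof.
move=> mb mf f0.
pose g z := (if b z then f z else 0)%E.
have mg : measurable_fun [set: T1 * T2] g by exact: measurable_fun_ifT.
have g0 z : (0 <= g z)%E by rewrite /g; case: ifP.
have := @fubini_tonelli _ _ _ _ _ m1 m2 g mg g0; rewrite /fubini_F /fubini_G /g => gE.
under eq_integral do rewrite integral_if.
by under [in RHS]eq_integral do rewrite integral_if.
Qed.

(** * Two elementary integrals *)

Section real_integrals.
Context {R : realType}.
Local Notation mu := (@lebesgue_measure R).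
Implicit Types p q r s c : R.

Lemma integral_exp_tail s c : 0 < s ->
  (\int[mu]_(x in `]c, +oo[) (expR (- (s * x)))%:E =
   (s^-1 * expR (- (s * c)))%:E)%E.
Proof.
move=> s0.
have cexp : continuous (fun x : R => expR (- (s * x))).
  move=> x; apply: continuous_comp; last exact: continuous_expR.
  by apply: continuousN; apply: continuousM => //; exact: cst_continuous.
have dF (x : R) : is_derive x 1 (fun x : R => - (s^-1 * expR (- (s * x))) : R)
    (expR (- (s * x))).
  have H : is_derive x 1 (fun x : R => expR (- (s * x)))
      (expR (- (s * x)) * - s).
    apply: (@is_derive1_comp _ (@expR R) (fun x => - (s * x))).
    by apply: is_derive_eq; rewrite /GRing.scale/= mulr1.
  apply: is_derive_eq.
  rewrite /GRing.scale/=; field.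
  by rewrite gt_eqF.
rewrite integral_itv_obnd_cbnd; last first.
  by apply/measurable_EFinP/measurable_funTS; exact: continuous_measurable_fun.
rewrite (@ge0_continuous_FTC2y _ _ (fun x => - (s^-1 * expR (- (s * x)))) _ 0).
- by rewrite EFinN oppeK add0e.
- by move=> x _; exact: expR_ge0.
- exact: continuous_subspaceT.
- rewrite -oppr0 -[X in - X](mulr0 s^-1); apply: cvgN; apply: cvgMl_tmp.
  apply: (@cvg_comp _ _ _ (fun x => s * x) (fun x => expR (- x)) _
           (pinfty_nbhs R)); last exact: cvgr_expR.
  exact: gt0_cvgMry.
- by move=> x _; have [] := dF x.
- apply: cvg_at_right_filter; apply: cvgN; apply: cvgMl_tmp; exact: cexp.
- by move=> x _; rewrite derive1E; have [_] := dF x.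
Qed.

(** For $p < 1$ the integrand is unbounded at 0, out of reach of the fundamental
theorem of calculus for functions continuous up to the endpoints; the integral
is the limit of those over $[c/(n+2), c]$. *)
Lemma integral_powR_primitive p c : 0 < p -> 0 <= c ->
  (\int[mu]_(z in `]0%R, c[) (p * z `^ (p - 1))%:E = (c `^ p)%:E)%E.
Proof.
move=> p0; rewrite le_eqVlt => /predU1P[<-|c0].
  by rewrite set_itv_ge ?bnd_simp ?ltxx// integral_set0 powR0// gt_eqF.
have mpow D : measurable_fun D (fun z : R => (p * z `^ (p - 1))%:E).
  apply/measurable_EFinP/measurable_funTS/measurable_funM => //.
rewrite integral_itv_bndo_bndc//.
pose u n := c / n.+2%:R.
have u0 n : 0 < u n by rewrite divr_gt0.
have uc n : u n < c.
  by rewrite /u ltr_pdivrMr// ltr_pMr// ltr1n.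
have -> : `]0, c]%classic = \bigcup_n `[u n, c]%classic.
  apply/seteqP; split => [z/=|z [n _] /=]; rewrite !in_itv/=.
    move=> /andP[z0 zc].
    exists (Num.bound (c / z)) => //=; rewrite in_itv/= zc andbT /u.
    rewrite ler_pdivrMr// mulrC -ler_pdivrMr//.
    apply/ltW/(lt_le_trans (archi_boundP _)); first by rewrite ltW// divr_gt0.
    by rewrite ler_nat; exact: leqW (leqnSn _).
  by move=> /andP[uz ->]; rewrite (lt_le_trans (u0 n) uz).
have lim1 : (\int[mu]_(z in `[u n, c]) (p * z `^ (p - 1))%:E @[n --> \oo] -->
    \int[mu]_(z in \bigcup_n `[u n, c]%classic) (p * z `^ (p - 1))%:E)%E.
  apply: ge0_nondecreasing_set_cvg_integral => //.
  - apply/nondecreasing_seqP => n; apply/subsetPset/subset_itvr.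
    by rewrite bnd_simp /u ler_pM2l// lef_pV2 ?posrE// ler_nat.
  - by move=> i; exact: mpow.
  - by move=> i x _; rewrite lee_fin mulr_ge0 ?powR_ge0 ?ltW.
apply: (cvg_unique _ lim1) => //.
have -> : (fun n => \int[mu]_(z in `[u n, c]) (p * z `^ (p - 1))%:E)%E =
    (fun n => (c `^ p - u n `^ p)%:E).
  apply/funext => n.
  rewrite (@continuous_FTC2 _ _ (fun z => z `^ p))//.
  - apply: derivable_within_continuous => z; rewrite in_itv/= => /andP[uz _].
    apply: derivableM => //; apply: derivable_powR.
    by rewrite in_itv/= andbT (lt_le_trans (u0 n)).
  - have dp z : 0 < z -> derivable ((@powR R)^~ p) z 1.
      by move=> z0; apply: derivable_powR; rewrite in_itv/= andbT.
    have cp z : 0 < z -> {for z, continuous ((@powR R)^~ p)}.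
      by move=> /dp/derivable1_diffP/differentiable_continuous.
    split.
    + move=> z; rewrite in_itv/= => /andP[uz _]; apply: dp.
      exact: lt_trans uz.
    + by apply: cvg_at_right_filter; exact: cp.
    + by apply: cvg_at_left_filter; exact: cp.
  - move=> z; rewrite in_itv/= => /andP[uz _]; rewrite powR_derive1//.
    by rewrite in_itv/= andbT (lt_trans (u0 n)).
apply: cvg_EFin; first by near=> n.
rewrite /comp/= -[X in _ --> X]subr0; apply: cvgB; first exact: cvg_cst.
have /cvg_at_rightP := powR_cvg0 p0; apply; split => //.
rewrite -[X in _ --> X](mulr0 c); apply: cvgMl_tmp.
rewrite /u.
by have := @cvg_harmonic R; rewrite -cvg_shiftS.
Unshelve. all: by end_near. Qed.

End real_integrals.

(** * The Gamma function *)

Section gamma.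
Context {R : realType}.
Local Notation mu := (@lebesgue_measure R).
Implicit Types p q r x y z : R.

Lemma ltr_powRV q z y : 0 < q -> 0 <= z -> 0 <= y ->
  (z `^ q < y) = (z < y `^ q^-1).
Proof.
move=> q0 z0 y0; apply/idP/idP => h.
  rewrite -[ltLHS]powRr1// -(@mulfV _ q) ?gt_eqF// powRrM.
  by apply: gt0_ltr_powR; rewrite ?invr_gt0// nnegrE ?powR_ge0.
rewrite -[ltRHS]powRr1// -(@mulVf _ q) ?gt_eqF// powRrM.
by apply: gt0_ltr_powR; rewrite // nnegrE ?powR_ge0.
Qed.

Lemma integral_expN_tail y :
  (\int[mu]_(x in `]y, +oo[) (expR (- x))%:E = (expR (- y))%:E)%E.
Proof.
have := @integral_exp_tail R 1 y ltr01; rewrite invr1 !mul1r => <-.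
by under [in RHS]eq_integral do rewrite mul1r.
Qed.

(** Euler's integral before truncation to a real number: equalities of
nonnegative integrals hold here prior to any proof of finiteness. *)
Definition extended_Gamma x : \bar R :=
  (\int[mu]_(u in `]0%R, +oo[) (u `^ (x - 1) * expR (- u))%:E)%E.

(** Substituting $e^{-r z^q} = \int_{w > r z^q} e^{-w} dw$ and exchanging the
integrals leaves, for each $w$, the integral of $p z^{p-1}$ over
$z < (w/r)^{1/q}$, which is $(w/r)^{p/q}$. *)
Lemma integral_powR_expN p q r : 0 < p -> 0 < q -> 0 < r ->
  (\int[mu]_(z in `]0%R, +oo[) (p * z `^ (p - 1) * expR (- (r * z `^ q)))%:E =
   (r `^ (- (p / q)))%:E * extended_Gamma (1 + p / q))%E.
Proof.
move=> p0 q0 r0.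
pose b (zw : R * R) := (0 < zw.1) && (r * zw.1 `^ q < zw.2).
pose f (zw : R * R) := (p * zw.1 `^ (p - 1) * expR (- zw.2))%:E.
have mb : measurable_fun [set: R * R] b.
  apply: measurable_and; apply: measurable_fun_ltr => //.
  apply: measurable_funM => //.
  exact: (measurableT_comp (measurable_powR q) measurable_fst).
have mf : measurable_fun [set: R * R] f.
  apply/measurable_EFinP; apply: measurable_funM.
    apply: measurable_funM => //.
    exact: (measurableT_comp (measurable_powR _) measurable_fst).
  by apply: measurableT_comp => //; exact: measurableT_comp.
have f0 zw : (0 <= f zw)%E.
  by rewrite lee_fin !mulr_ge0 ?powR_ge0 ?expR_ge0// ltW.
have -> : (\int[mu]_(z in `]0%R, +oo[)
      (p * z `^ (p - 1) * expR (- (r * z `^ q)))%:E =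
    \int[mu]_z \int[mu]_(w in [set w | b (z, w)]) f (z, w))%E.
  rewrite integral_mkcond; apply: eq_integral => z _.
  rewrite patchE mem_setE in_itv/= andbT /b/= /f/=.
  case: ifPn => z0; last by rewrite integral_if integral0.
  transitivity ((p * z `^ (p - 1))%:E *
      \int[mu]_(w in `](r * z `^ q)%R, +oo[) (expR (- w))%:E)%E.
    by rewrite integral_expN_tail.
  rewrite -ge0_integralZl_EFin//.
  - by rewrite set_itvoy.
  - by apply/measurable_EFinP; apply: measurable_funTS; exact: measurableT_comp.
  - by rewrite mulr_ge0 ?powR_ge0 ?ltW.
rewrite tonelli_region// /extended_Gamma -ge0_integralZl_EFin//; last 3 first.
- by move=> w _; rewrite lee_fin mulr_ge0 ?powR_ge0 ?expR_ge0.
- apply/measurable_EFinP; apply: measurable_funTS; apply: measurable_funM => //.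
  exact: measurableT_comp.
- exact: powR_ge0.
rewrite [RHS]integral_mkcond; apply: eq_integral => w _.
rewrite patchE mem_setE in_itv/= andbT /b/= /f/=.
case: ifPn => w0; last first.
  rewrite (_ : [set _ | _] = set0) ?integral_set0//.
  rewrite -subset0 => z /= /andP[z0 zw]; move: w0; rewrite -leNgt leNgt => /negP; apply.
  by apply: le_lt_trans zw; rewrite mulr_ge0 ?powR_ge0 ?ltW.
have wr0 : 0 <= w / r by rewrite divr_ge0 ?ltW.
rewrite (_ : [set _ | _] = `]0, (w / r) `^ q^-1[%classic); last first.
  rewrite set_itvoo; apply/seteqP; split => z /= /andP[z0].
    by rewrite mulrC -ltr_pdivlMr// ltr_powRV ?(ltW z0)// z0.
  by rewrite -ltr_powRV ?(ltW z0)// ltr_pdivlMr// mulrC z0.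
under eq_integral do rewrite EFinM muleC.
rewrite ge0_integralZl_EFin ?expR_ge0//; last 2 first.
- by move=> z _; rewrite lee_fin mulr_ge0 ?powR_ge0 ?ltW.
- apply/measurable_EFinP; apply: measurable_funTS; exact: measurable_funM.
have powE : ((w / r) `^ q^-1) `^ p = r `^ (- (p / q)) * w `^ (p / q).
  rewrite -powRrM (mulrC q^-1) powRM ?invr_ge0 ?(ltW w0) ?(ltW r0)//.
  by rewrite -(powR_inv1 (ltW r0)) -powRrM mulN1r [LHS]mulrC.
rewrite integral_powR_primitive ?powR_ge0// powE -!EFinM.
by rewrite [1 + _]addrC addrK mulrC mulrA.
Qed.

Let measurable_gamma_integrand D p :
  measurable_fun D (fun u : R => (u `^ p * expR (- u))%:E).
Proof.
apply/measurable_EFinP/measurable_funTS; apply: measurable_funM => //.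
exact: measurableT_comp.
Qed.

Let gamma_integrand_ge0 p u : (0 <= (u `^ p * expR (- u))%:E)%E.
Proof. by rewrite lee_fin mulr_ge0 ?powR_ge0 ?expR_ge0. Qed.

(** This is [integral_powR_expN] at $q = r = 1$. *)
Lemma extended_GammaS p : 0 < p ->
  (extended_Gamma (1 + p) = p%:E * extended_Gamma p)%E.
Proof.
move=> p0; have := integral_powR_expN _ _ _ p0 (@ltr01 R) (@ltr01 R).
rewrite powR1 mul1e divr1 => <-.
rewrite /extended_Gamma -ge0_integralZl_EFin//; last 2 first.
- exact: measurable_gamma_integrand.
- exact: ltW.
apply: eq_integral => z; rewrite inE/= in_itv/= andbT => z0.
by rewrite mul1r powRr1 ?ltW// -EFinM mulrA.
Qed.

Lemma extended_Gamma1 : extended_Gamma 1 = 1%E.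
Proof.
rewrite /extended_Gamma; under eq_integral do rewrite subrr powRr0 mul1r.
by rewrite integral_expN_tail oppr0 expR0.
Qed.

Lemma extended_Gamma_fact n : extended_Gamma (1 + n%:R) = (n`!%:R)%:E.
Proof.
elim: n => [|n IHn]; first by rewrite addr0 extended_Gamma1.
by rewrite extended_GammaS// -natr1 addrC IHn -EFinM nat1r -natrM factS.
Qed.

(** Compare $u^p$ with $1 + u^n$ for an integer $n \ge p$, whose integral against
$e^{-u}$ is $1 + n!$. *)
Lemma extended_Gamma_lty p : 0 <= p -> (extended_Gamma (1 + p) < +oo)%E.
Proof.
move=> p0; pose n := Num.bound p.
have pn : p <= n%:R by rewrite ltW// archi_boundP.
have -> : extended_Gamma (1 + p) =
    (\int[mu]_(u in `]0%R, +oo[) (u `^ p * expR (- u))%:E)%E.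
  by rewrite /extended_Gamma [1 + p]addrC addrK.
apply: (@le_lt_trans _ _ (extended_Gamma 1 + extended_Gamma (1 + n%:R)))%E; last first.
  by rewrite extended_Gamma1 extended_Gamma_fact -EFinD ltry.
rewrite /extended_Gamma -ge0_integralD//; [|exact: measurable_gamma_integrand..].
apply: ge0_le_integral => //.
- exact: measurable_gamma_integrand.
- by apply: emeasurable_funD; exact: measurable_gamma_integrand.
move=> u; rewrite /= in_itv/= andbT => u0.
rewrite -EFinD lee_fin -mulrDl ler_wpM2r ?expR_ge0//.
rewrite subrr powRr0 [1 + _]addrC addrK.
have [u1|u1] := leP 1 u.
  by rewrite (le_trans (ler_powR u1 pn))// lerDr.
rewrite (@le_trans _ _ 1)// ?lerDl ?powR_ge0//.
by rewrite -(powRr0 u) ger_powR// u0 ltW.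
Qed.

(** Keep only the part $u > y$ of Euler's integral, where $u^p \ge y^p$. *)
Lemma extended_Gamma_ge p y : 0 <= p -> 0 <= y ->
  ((y `^ p * expR (- y))%:E <= extended_Gamma (1 + p))%E.
Proof.
move=> p0 y0; rewrite EFinM -integral_expN_tail -ge0_integralZl_EFin//; last 2 first.
- by apply/measurable_EFinP; apply: measurable_funTS; exact: measurableT_comp.
- exact: powR_ge0.
apply: (@le_trans _ _ (\int[mu]_(u in `]y, +oo[) (u `^ p * expR (- u))%:E)%E).
  apply: ge0_le_integral => //.
  - by move=> u _; rewrite -EFinM lee_fin mulr_ge0 ?powR_ge0 ?expR_ge0.
  - apply: emeasurable_funM => //.
    by apply/measurable_EFinP; apply: measurable_funTS; exact: measurableT_comp.
  - exact: measurable_gamma_integrand.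
  move=> u; rewrite /= in_itv/= andbT => yu.
  have u0 : 0 <= u by rewrite (le_trans y0)// ltW.
  rewrite -EFinM lee_fin ler_wpM2r ?expR_ge0//.
  by apply: ge0_ler_powR; rewrite ?nnegrE// ltW.
rewrite /extended_Gamma [1 + p]addrC addrK; apply: ge0_subset_integral => //.
  exact: measurable_gamma_integrand.
by apply: subset_itvr; rewrite bnd_simp.
Qed.

Lemma EFin_Gamma p : 0 <= p -> (Gamma (1 + p))%:E = extended_Gamma (1 + p).
Proof.
move=> p0; rewrite /Gamma /Rintegral fineK// ge0_fin_numE.
  exact: extended_Gamma_lty.
exact: integral_ge0.
Qed.

Lemma Gamma1_gt0 p : 0 <= p -> 0 < Gamma (1 + p).
Proof.
move=> p0; rewrite -lte_fin EFin_Gamma//.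
apply: lt_le_trans (extended_Gamma_ge _ _ p0 ler01).
by rewrite powR1 mul1r lte_fin expR_gt0.
Qed.

End gamma.

(** * Moments of negative powers of a positive stable variable *)

Section positive_stable.
Context {K : realType} {d : measure_display} {T : measurableType d}.
Context {P : probability T K} (X : {RV P >-> K}) (a : K).
Local Notation mu := (@lebesgue_measure K).

Definition positive_stable := forall z : K, 0 < z ->
  ('E_P[fun w => expR (- (z * X w))] = (expR (- (z `^ a)))%:E)%E.

(** Expectations are taken over this event, of probability 1, so that
identities requiring $X > 0$ hold at every point of the domain. *)
Definition positivity_event : set T := [set w | 0 < X w].
Local Notation D := positivity_event.

Lemma measurable_pos : measurable D.
Proof.
have -> : D = X @^-1` `]0, +oo[%classic.
  by apply/seteqP; split => w /=; rewrite in_itv/= andbT.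
exact: measurable_funPTI.
Qed.

Let mexp z : measurable_fun [set: T] (fun w => (expR (- (z * X w)))%:E).
Proof.
apply/measurable_EFinP; apply: measurableT_comp => //.
by apply: measurableT_comp => //; exact: measurable_funM.
Qed.

(** Markov's inequality: $e^{-zX} \ge 1$ where $X \le 0$, so
$P(X \le 0) \le e^{-z^a}$ for all $z > 0$. *)
Lemma probability_pos_compl : 0 < a -> positive_stable -> P (~` D) = 0%E.
Proof.
move=> a0 hX.
have mDC : measurable (~` D) by apply: measurableC; exact: measurable_pos.
have PD z : 0 < z -> (P (~` D) <= (expR (- (z `^ a)))%:E)%E.
  move=> z0; rewrite -hX// unlock.
  rewrite -[leLHS]mul1e -integral_cst//.
  apply: (@le_trans _ _ (\int[P]_(w in ~` D) (expR (- (z * X w)))%:E)%E).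
    apply: ge0_le_integral => //.
    - exact: measurable_funTS.
    move=> w /=/negP; rewrite -leNgt => Xw.
    by rewrite lee_fin -expR0 ler_expR oppr_ge0 pmulr_rle0.
  by apply: ge0_subset_integral => //; exact: mexp.
apply/eqP; rewrite eq_le measure_ge0 andbT leNgt; apply/negP => P0.
have [r Pr] : exists r, P (~` D) = r%:E.
  by exists (fine (P (~` D))); rewrite fineK// fin_num_measure.
have r0 : 0 < r by rewrite -lte_fin -Pr.
have r1 : r <= 1 by rewrite -lee_fin -Pr probability_le1.
have l0 : 0 < - ln (r / 2).
  by rewrite oppr_gt0 ln_lt0// divr_gt0//= ltr_pdivrMr// mul1r (le_lt_trans r1)// ltr1n.
(* This $z$ makes the bound $e^{-z^a}$ equal to half of $r = P(X \le 0)$. *)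
have := PD ((- ln (r / 2)) `^ a^-1) (powR_gt0 _ l0).
rewrite Pr lee_fin -powRrM mulVf ?gt_eqF// powRr1 ?(ltW l0)// opprK lnK ?posrE ?divr_gt0//.
by apply/negP; rewrite -ltNge ltr_pdivrMr// ltr_pMr// ltr1n.
Qed.

Lemma integral_pos_part (f : T -> \bar K) : 0 < a -> positive_stable ->
  measurable_fun [set: T] f -> (forall w, 0 <= f w)%E ->
  (\int[P]_(w in D) f w = \int[P]_w f w)%E.
Proof.
move=> a0 hX mf f0.
rewrite [RHS](@ge0_negligible_integral _ _ _ _ _ (~` D))//.
- by rewrite setDE setCK setTI.
- by apply: measurableC; exact: measurable_pos.
- exact: probability_pos_compl.
Qed.

(** With $p = ak$, the integral of $p z^{p-1} e^{-z^a}$ over $z > 0$ equals $k!$;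
replacing $e^{-z^a}$ by $E[e^{-zX}]$ and exchanging, it also equals
$\Gamma(1 + p) E[X^{-p}]$. *)
Lemma moment_positive_stable k : 0 < a -> positive_stable ->
  (\int[P]_(w in D) (X w `^ (- (a * k%:R)))%:E =
   (k`!%:R / Gamma (1 + a * k%:R))%:E)%E.
Proof.
move=> a0 hX; have [->|k0] := posnP k.
  (* [integral_powR_expN] needs $p > 0$, so $k = 0$ is treated apart. *)
  under eq_integral do rewrite mulr0 oppr0 powRr0.
  have -> : Gamma (1 + a * 0%:R) = 1.
    by apply: EFin_inj; rewrite mulr0 EFin_Gamma// addr0 extended_Gamma1.
  rewrite integral_pos_part//.
  by rewrite integral_cst// mul1e divr1; exact: probability_setT.
pose p := a * k%:R; rewrite -/p.
have p0 : 0 < p by rewrite mulr_gt0// ltr0n.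
have pa : p / a = k%:R by rewrite /p mulrAC divff ?mul1r// gt_eqF.
have mpow q : measurable_fun [set: T] (fun w => (X w `^ q)%:E).
  by apply/measurable_EFinP; exact: (measurableT_comp (measurable_powR q)).
pose b (zw : K * T) := (0 < zw.1) && (0 < X zw.2).
pose f (zw : K * T) := (p * zw.1 `^ (p - 1) * expR (- (zw.1 * X zw.2)))%:E.
have mX : measurable_fun [set: K * T] (fun zw => X zw.2) by exact: measurableT_comp.
have mb : measurable_fun [set: K * T] b.
  by apply: measurable_and; apply: measurable_fun_ltr.
have mf : measurable_fun [set: K * T] f.
  apply/measurable_EFinP; apply: measurable_funM.
    apply: measurable_funM => //.
    exact: (measurableT_comp (measurable_powR _) measurable_fst).
  apply: measurableT_comp => //; apply: measurableT_comp => //.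
  exact: measurable_funM.
have f0 zw : (0 <= f zw)%E.
  by rewrite lee_fin !mulr_ge0 ?powR_ge0 ?expR_ge0// ltW.
have := integral_powR_expN p a 1 p0 a0 ltr01.
rewrite powR1 mul1e pa extended_Gamma_fact.
have -> : (\int[mu]_(z in `]0%R, +oo[)
      (p * z `^ (p - 1) * expR (- (1 * z `^ a)))%:E =
    \int[mu]_z \int[P]_(w in [set w | b (z, w)]) f (z, w))%E.
  rewrite integral_mkcond; apply: eq_integral => z _.
  rewrite patchE mem_setE in_itv/= andbT /b/= /f/=.
  case: ifPn => z0; last by rewrite integral_if integral0.
  under [in RHS]eq_integral do rewrite EFinM.
  rewrite mul1r EFinM -hX// unlock -integral_pos_part//.
  rewrite ge0_integralZl_EFin//.
  - exact: measurable_pos.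
  - exact: measurable_funTS.
  - by rewrite mulr_ge0 ?powR_ge0 ?ltW.
rewrite tonelli_region//.
have -> : (\int[P]_w \int[mu]_(z in [set z | b (z, w)]) f (z, w) =
    (Gamma (1 + p))%:E * \int[P]_(w in D) (X w `^ (- p))%:E)%E.
  rewrite -ge0_integralZl_EFin//; last 4 first.
  - exact: measurable_pos.
  - by move=> w _; rewrite lee_fin powR_ge0.
  - exact: measurable_funTS.
  - by rewrite ltW// Gamma1_gt0// ltW.
  rewrite [RHS]integral_mkcond; apply: eq_integral => w _.
  rewrite patchE /b/= /f/=; case: ifPn => [|/negP]; rewrite inE => X0; last first.
    rewrite (_ : [set _ | _] = set0) ?integral_set0// -subset0.
    by move=> z /= /andP[_].
  have := integral_powR_expN p 1 (X w) p0 ltr01 X0.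
  rewrite divr1 EFin_Gamma ?(ltW p0)// muleC => <-.
  have -> : [set z : K | (0 < z) && (0 < X w)] = `]0, +oo[%classic.
    by rewrite set_itvoy; apply/seteqP; split => z /=; rewrite X0 andbT.
  apply: eq_integral => z; rewrite inE/= in_itv/= andbT => z0.
  by rewrite powRr1 ?(ltW z0)// [X w * _]mulrC.
have G0 : 0 < Gamma (1 + p) by rewrite Gamma1_gt0// ltW.
set I := (\int[P]_(w in D) _)%E => GI.
have -> : I = ((Gamma (1 + p))^-1%:E * ((Gamma (1 + p))%:E * I))%E.
  by rewrite muleA -EFinM mulVf ?gt_eqF// mul1e.
by rewrite GI -EFinM mulrC.
Qed.

(** * The Laplace transform as a Mittag-Leffler function *)

(** Choose $y$ with $y^a = 2c$: then $\Gamma(1 + ak) \ge (2c)^k e^{-y}$, so the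
terms are at most $e^y 2^{-k}$. *)
Lemma mittag_leffler_series_ub (c : K) : 0 < a -> 0 < c ->
  exists C, forall n,
    series (fun k => c ^+ k / Gamma (1 + a * k%:R)) n <= C.
Proof.
move=> a0 c0; pose y := (2 * c) `^ a^-1.
have c2 : 0 <= 2 * c by rewrite mulr_ge0 ?ltW.
have yE k : y `^ (a * k%:R) = (2 * c) ^+ k.
  by rewrite -powRrM mulrA mulVf ?gt_eqF// mul1r powR_mulrn.
exists (expR y * 2) => n.
(* The geometric sum is kept in closed form to make the induction go through. *)
suff : series (fun k => c ^+ k / Gamma (1 + a * k%:R)) n <=
    expR y * (2 - 2 * 2^-1 ^+ n).
  move=> /le_trans; apply; rewrite ler_pM2l ?expR_gt0//.
  by rewrite gerBl mulr_ge0// exprn_ge0// invr_ge0.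
elim: n => [|n IHn]; first by rewrite /series/= big_geq// expr0 mulr1 subrr mulr0.
rewrite seriesSr (_ : expR y * _ =
  expR y * (2 - 2 * 2^-1 ^+ n) + expR y * 2^-1 ^+ n); last by rewrite exprS; field.
apply: lerD => //.
have an0 : 0 <= a * n%:R by rewrite mulr_ge0// ltW.
rewrite ler_pdivrMr ?Gamma1_gt0//.
have : (2 * c) ^+ n * expR (- y) <= Gamma (1 + a * n%:R).
  by rewrite -lee_fin EFin_Gamma// -yE extended_Gamma_ge// powR_ge0.
rewrite -(ler_pM2l (expR_gt0 y)) => H.
rewrite mulrAC mulrC -ler_pdivrMl ?exprn_gt0 ?invr_gt0//.
apply: le_trans H; rewrite exprMn mulrCA -expRD subrr expR0 mulr1.
by rewrite -exprVn invrK.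
Qed.

Let M w := X w `^ (- a).

Let M_ge0 w : 0 <= M w. Proof. exact: powR_ge0. Qed.

Let mM : measurable_fun [set: T] M.
Proof. exact: (measurableT_comp (measurable_powR _)). Qed.

Let exp_coeff_M c w k :
  exp_coeff (c * M w) k = c ^+ k / k`!%:R * X w `^ (- (a * k%:R)).
Proof.
rewrite /exp_coeff/= exprMn -[M w ^+ k]powR_mulrn//.
by rewrite /M -powRrM mulNr mulrAC.
Qed.

Lemma integral_exp_partial_sum (c : K) n : 0 < a -> positive_stable ->
  (\int[P]_(w in D) (series (exp_coeff (c * M w)) n)%:E =
   (series (fun k => c ^+ k / Gamma (1 + a * k%:R)) n)%:E)%E.
Proof.
move=> a0 hX.
have mpow q : measurable_fun [set: T] (fun w => (X w `^ q)%:E).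
  by apply/measurable_EFinP; exact: (measurableT_comp (measurable_powR q)).
have iX k : P.-integrable D (fun w => (X w `^ (- (a * k%:R)))%:E).
  apply/integrableP; split; first exact: measurable_funTS.
  under eq_integral do rewrite gee0_abs ?lee_fin ?powR_ge0//.
  by rewrite moment_positive_stable// ltry.
under eq_integral do rewrite /series/= -sumEFin.
rewrite integral_sum//; last 2 first.
- exact: measurable_pos.
- move=> k; under eq_fun do rewrite exp_coeff_M EFinM.
  by apply: integrableZl => //; exact: measurable_pos.
rewrite /series/= -sumEFin; apply: eq_bigr => k _.
under eq_integral do rewrite exp_coeff_M EFinM.
rewrite integralZl//; last exact: measurable_pos.
rewrite moment_positive_stable// -EFinM; congr EFin.
by rewrite mulrA divfK// pnatr_eq0 -lt0n fact_gt0.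
Qed.

Let series_exp_coeff_le (x : K) n :
  0 <= x -> series (exp_coeff x) n <= expR x.
Proof.
move=> x0; apply: nondecreasing_cvgn_le; last exact: is_cvg_series_exp_coeff.
apply: nondecreasing_series => k _ _.
by rewrite /exp_coeff/= divr_ge0// exprn_ge0.
Qed.

Let measurable_series_exp_coeff c n :
  measurable_fun [set: T] (fun w => (series (exp_coeff (c * M w)) n)%:E).
Proof.
apply/measurable_EFinP; rewrite /series/=; apply: measurable_sum => k.
under eq_fun do rewrite exp_coeff_M.
apply: measurable_funM => //.
exact: (measurableT_comp (measurable_powR _)).
Qed.

Let measurable_exp_M c : measurable_fun [set: T] (fun w => (expR (c * M w))%:E).
Proof.
apply/measurable_EFinP; apply: measurableT_comp => //.
exact: measurable_funM.
Qed.

(** By monotone convergence, $E[e^{cM}]$ is the limit of the sums of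
$c^k / \Gamma(1 + ak)$, which are bounded. *)
Lemma integrable_exp_M (c : K) : 0 < a -> positive_stable -> 0 < c ->
  P.-integrable D (fun w => (expR (c * M w))%:E).
Proof.
move=> a0 hX c0; have [C HC] := mittag_leffler_series_ub c a0 c0.
have cM0 w : 0 <= c * M w by rewrite mulr_ge0// ltW.
apply/integrableP; split; first exact: measurable_funTS.
under eq_integral do rewrite gee0_abs ?lee_fin ?expR_ge0//.
apply: (@le_lt_trans _ _ C%:E); last exact: ltry.
have nd w : {homo (fun n => (series (exp_coeff (c * M w)) n)%:E) :
    n m / (n <= m)%N >-> (n <= m)%E}.
  move=> n m nm; rewrite lee_fin; apply: nondecreasing_series nm => k _ _.
  by rewrite /exp_coeff/= divr_ge0// exprn_ge0.
have -> : (\int[P]_(w in D) (expR (c * M w))%:E =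
    \int[P]_(w in D) limn (fun n => (series (exp_coeff (c * M w)) n)%:E))%E.
  by apply: eq_integral => w _; rewrite EFin_lim//; exact: is_cvg_series_exp_coeff.
rewrite monotone_convergence//; last 3 first.
- exact: measurable_pos.
- by move=> n; exact: measurable_funTS.
- move=> n w _; rewrite lee_fin; apply: sumr_ge0 => k _.
  by rewrite /exp_coeff/= divr_ge0// exprn_ge0.
apply: lime_le.
  apply: ereal_nondecreasing_is_cvgn => n m nm; apply: ge0_le_integral => //.
  - exact: measurable_pos.
  - move=> w _; rewrite lee_fin; apply: sumr_ge0 => k _.
    by rewrite /exp_coeff/= divr_ge0// exprn_ge0.
  - exact: measurable_funTS.
  - exact: measurable_funTS.
  - by move=> w _; exact: nd.
by near=> n; rewrite integral_exp_partial_sum// lee_fin.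
Unshelve. all: by end_near. Qed.

(** Dominated convergence for the exponential series of $-cM$, with dominating
function $e^{cM}$. *)
Lemma laplace_neg_power_stable (c : K) : 0 < a -> positive_stable -> 0 < c ->
  (\int[P]_(w in D) (expR (- (c * X w `^ (- a))))%:E =
   (mittag_leffler a (- c))%:E)%E.
Proof.
move=> a0 hX c0.
have mD := measurable_pos.
pose f_ n w := (series (exp_coeff (- c * M w)) n)%:E.
have cvg_f w : f_ n w @[n --> \oo] --> (expR (- c * M w))%:E.
  by apply: cvg_EFin; [exact: nearW|exact: is_cvg_series_exp_coeff].
have f_le n w : (`|f_ n w| <= (expR (c * M w))%:E)%E.
  rewrite lee_fin; apply: le_trans (series_exp_coeff_le (c * M w) n _); last first.
    by rewrite mulr_ge0// ltW.
  apply: le_trans (ler_norm_sum _ _ _) _; apply: ler_sum => k _.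
  rewrite /exp_coeff/= normrM normrX normrM normrN (gtr0_norm c0).
  by rewrite (ger0_norm (M_ge0 w)) ger0_norm.
have [iexp _] := @dominated_convergence _ _ _ P D mD f_
  (fun w => (expR (- c * M w))%:E) (fun w => (expR (c * M w))%:E)
  (fun n => measurable_funTS (measurable_series_exp_coeff (- c) n))
  (measurable_funTS (measurable_exp_M (- c)))
  (aeW _ (fun w _ => cvg_f w)) (integrable_exp_M c a0 hX c0)
  (aeW _ (fun w n _ => f_le n w)).
have -> : (\int[P]_(w in D) (expR (- (c * X w `^ (- a))))%:E =
    \int[P]_(w in D) (expR (- c * M w))%:E)%E.
  by apply: eq_integral => w _; rewrite mulNr.
rewrite -(fineK (integrable_fin_num mD iexp)) /f_.
under eq_fun do rewrite integral_exp_partial_sum//.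
move=> /fine_cvg h; congr EFin; exact/esym/cvg_lim.
Qed.

End positive_stable.

(** * The integral of the tail *)

Theorem mainTheorem19 (K : realType) (a : K) (ha0 : 0 < a) (ha1 : a < 1)
    (d : measure_display) (T : measurableType d) (P : probability T K)
    (R : {RV P >-> K})
    (hR0 : {ae P, forall w, 0 <= R w})
    (hR : forall z : K, 0 < z ->
       ('E_P[fun w => expR (- (z * R w))] = (expR (- (z `^ a)))%:E)%E)
    (s t : K) (hs : 0 < s) (ht : 0 < t) :
  (\int[lebesgue_measure]_(x in `]0%R, +oo[)
      ((expR (- (s * x)))%:E * (1 - cdf R (t / (x `^ (1 / a)))%R))
    = (1 / s * mittag_leffler a (- (s * t `^ a)))%:E)%E.
Proof.
have hX : positive_stable R a by [].
have mD := @measurable_pos _ _ _ _ R.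
set mu := @lebesgue_measure K.
pose b (xw : K * T) := (0 < xw.1) && (t / xw.1 `^ (1 / a) < R xw.2).
pose f (xw : K * T) := (expR (- (s * xw.1)))%:E.
have mR : measurable_fun [set: K * T] (fun xw => R xw.2) by exact: measurableT_comp.
have mb : measurable_fun [set: K * T] b.
  apply: measurable_and; apply: measurable_fun_ltr => //.
  apply: measurable_funM => //.
  under eq_fun do rewrite -powRN.
  exact: (measurableT_comp (measurable_powR _) measurable_fst).
have mf : measurable_fun [set: K * T] f.
  apply/measurable_EFinP; apply: measurableT_comp => //.
  apply: measurableT_comp => //; exact: measurable_funM.
have f0 xw : (0 <= f xw)%E by rewrite lee_fin expR_ge0.
have ccdfE y : (1 - cdf R y)%E = P [set w | y < R w].
  rewrite (_ : [set w | y < R w] = ~` (R @^-1` `]-oo, y]%classic)).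
    by rewrite probability_setC//; exact: measurable_funPTI.
  apply/seteqP; split => w /=; rewrite in_itv/= ltNge; first by move/negP.
  by move=> /negP.
have mRy y : measurable [set w | y < R w].
  rewrite (_ : [set _ | _] = R @^-1` `]y, +oo[%classic); first exact: measurable_funPTI.
  by rewrite set_itvoy.
have -> : (\int[mu]_(x in `]0%R, +oo[)
      ((expR (- (s * x)))%:E * (1 - cdf R (t / (x `^ (1 / a)))%R)) =
    \int[mu]_x \int[P]_(w in [set w | b (x, w)]) f (x, w))%E.
  rewrite [LHS]integral_mkcond; apply: eq_integral => x _.
  rewrite patchE mem_setE in_itv/= andbT /b/= /f/=.
  case: ifPn => x0; last by rewrite integral_if integral0.
  by rewrite ccdfE integral_cst//; exact: mRy.
(* For fixed $w$ with $R > 0$ the condition on $x$ becomes $(t/R)^a < x$; if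
   $R \le 0$ it never holds, since $t / x^{1/a} \ge 0$. *)
rewrite tonelli_region//.
have -> : (\int[P]_w \int[mu]_(x in [set x | b (x, w)]) f (x, w) =
    (s^-1)%:E * \int[P]_(w in positivity_event R)
       (expR (- (s * t `^ a * R w `^ (- a))))%:E)%E.
  rewrite -ge0_integralZl_EFin//; last 2 first.
  - apply/measurable_EFinP/measurable_funTS; apply: measurableT_comp => //.
    apply: measurableT_comp => //; apply: measurable_funM => //.
    exact: (measurableT_comp (measurable_powR _)).
  - by rewrite invr_ge0 ltW.
  rewrite [RHS]integral_mkcond; apply: eq_integral => w _.
  rewrite patchE /b/= /f/=; case: ifPn => [|/negP]; rewrite inE => R0; last first.
    rewrite (_ : [set _ | _] = set0) ?integral_set0// -subset0.
    move=> x /= /andP[x0 tR]; apply: R0; rewrite /positivity_event/=.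
    by apply: le_lt_trans tR; rewrite divr_ge0 ?powR_ge0 ?ltW.
  rewrite (_ : [set _ | _] = `](t / R w) `^ a, +oo[%classic); last first.
    have tR0 : 0 < t / R w by rewrite divr_gt0.
    have E x : 0 < x -> (t / x `^ (1 / a) < R w) = ((t / R w) `^ a < x).
      move=> x0; rewrite ltr_powRV ?(ltW x0) ?(ltW tR0)// div1r.
      by rewrite ltr_pdivrMr ?powR_gt0// ltr_pdivrMr// mulrC.
    rewrite set_itvoy; apply/seteqP; split => x /=.
      by move=> /andP[x0]; rewrite E.
    move=> tx; have x0 : 0 < x by rewrite (le_lt_trans _ tx)// powR_ge0.
    by rewrite x0 E.
  rewrite integral_exp_tail// -EFinM; congr (_ * expR (- _))%:E.
  rewrite powRM ?invr_ge0 ?(ltW ht) ?(ltW R0)// mulrA; congr (_ * _).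
  by rewrite -(powR_inv1 (ltW R0)) -powRrM mulN1r.
rewrite laplace_neg_power_stable//; last by rewrite mulr_gt0// powR_gt0.
by rewrite -EFinM div1r.
Qed.
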